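(* Let $X$ be a unital regular poly-bicategory. The following conditions are equivalent: 1. for all 0-cells $x$ of $X$, there exist a 0-cell $\overline{x}$ and a tensor universal 1-cell $e: x \to \overline{x}$; 2. for all 0-cells $x$ of $X$, there exist a 0-cell $\overline{x}$ and a tensor universal 1-cell $e': \overline{x} \to x$; 3. for all 0-cells $x$ of $X$, there exists a tensor unit $1_x$ on $x$.
   Context: A regular 2-polygraph $X$ consists of a set of 0-cells, a set of 1-cells $a: x \to y$ (each with a source and a target 0-cell), and, for all $n,m\ge 1$, a set of 2-cells $p:(a_1,\ldots,a_n)\to(b_1,\ldots,b_m)$, whose input $(a_i)$ and output $(b_j)$ are non-empty composable sequences of 1-cells (the target of each is the source of the next) with the same initial source and the same final target; write $\partial_i^-p=a_i$, $\partial_j^+p=b_j$. Greek capitals denote possibly empty composable sequences of 1-cells, and commas denote concatenation. A (non-unital) regular poly-bicategory is a regular 2-polygraph with operations $\mathrm{cut}_{j,i}$: given $t:(\Gamma)\to(\Delta_1,a,\Delta_2)$ and $s:(\Gamma_1,a,\Gamma_2)\to(\Delta)$, where the displayed $a$ is the $j$-th output of $t$ and the $i$-th input of $s$, such that ($\Gamma_1$ or $\Delta_1$ is empty) and ($\Gamma_2$ or $\Delta_2$ is empty), there is a composite 2-cell $\mathrm{cut}_{j,i}(t,s):(\Gamma_1,\Gamma,\Gamma_2)\to(\Delta_1,\Delta,\Delta_2)$. These satisfy associativity and interchange: whenever three 2-cells can be composed by two cuts, along the same two identified 1-cells, in two different orders, the two results are equal (e.g. $\mathrm{cut}_{j,1}(t,\mathrm{cut}_{i,1}(s,r))=\mathrm{cut}_{i+j-1,1}(\mathrm{cut}_{j,1}(t,s),r)$).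 No unit cells are part of the structure. Universality. A 2-cell $t:(\Gamma)\to(\Delta_1,a,\Delta_2)$, with $a$ in $j$-th position, is universal at $\partial_j^+$ if for all $\Gamma_1,\Gamma_2$ and non-empty $\Delta$ with ($\Gamma_1$ or $\Delta_1$ empty) and ($\Gamma_2$ or $\Delta_2$ empty), every 2-cell $s:(\Gamma_1,\Gamma,\Gamma_2)\to(\Delta_1,\Delta,\Delta_2)$ equals $\mathrm{cut}(t,r)$, composed along $a$, for a unique $r:(\Gamma_1,a,\Gamma_2)\to(\Delta)$. Dually, $t:(\Gamma_1,a,\Gamma_2)\to(\Delta)$, with $a$ in $i$-th position, is universal at $\partial_i^-$ if for all $\Delta_1,\Delta_2$ and non-empty $\Gamma$ with ($\Gamma_1$ or $\Delta_1$ empty) and ($\Gamma_2$ or $\Delta_2$ empty), every $s:(\Gamma_1,\Gamma,\Gamma_2)\to(\Delta_1,\Delta,\Delta_2)$ equals $\mathrm{cut}(r,t)$, composed along $a$, for a unique $r:(\Gamma)\to(\Delta_1,a,\Delta_2)$. A unit on a 1-cell $a$ is a 2-cell $\mathrm{id}_a:(a)\to(a)$ such that every cut with $\mathrm{id}_a$, on either side, returns the other 2-cell. $X$ is unital if every 1-cell has a unit. Tensor units. A 1-cell $1_x: x\to x$ is a tensor unit on $x$ if for each 1-cell $a: x\to y$ there is a 2-cell $l_a:(1_x,a)\to(a)$ universal at both $\partial_1^+$ and $\partial_2^-$, and for each 1-cell $b:z\to x$ there is a 2-cell $r_b:(b,1_x)\to(b)$ universal at both $\partial_1^+$ and $\partial_1^-$.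 Tensor universality. Let $e: x \to x'$ be a 1-cell. It is tensor left universal if for each 1-cell $a: x\to y$ there exist a 1-cell $u: x'\to y$ and a 2-cell $(e,u)\to(a)$ universal at both $\partial_1^+$ and $\partial_2^-$, and for each 1-cell $a':x'\to y$ there exist a 1-cell $v: x\to y$ and a 2-cell $(e,a')\to(v)$ universal at both $\partial_1^+$ and $\partial_2^-$. It is tensor right universal if for each $b': z\to x'$ there exist $u: z\to x$ and a 2-cell $(u,e)\to(b')$ universal at both $\partial_1^+$ and $\partial_1^-$, and for each $b:z\to x$ there exist $v: z\to x'$ and a 2-cell $(b,e)\to(v)$ universal at both $\partial_1^+$ and $\partial_1^-$. It is tensor universal if it is both tensor left and tensor right universal. *)

(* Defs.v *)
From mathcomp Require Import all_boot.

Set Implicit Arguments.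
Unset Strict Implicit.
Unset Printing Implicit Defensive.

(** Cells are kept in flat types with boundary maps rather than in families
    indexed by their boundary, so that equality of 2-cells with different-looking
    boundaries (e.g. up to associativity of [++]) is plain equality. *)

Fixpoint is_path (C0 C1 : Type) (src tgt : C1 -> C0)
    (x : C0) (s : seq C1) (y : C0) : Prop :=
  match s with
  | [::] => x = y
  | a :: s' => src a = x /\ is_path src tgt (tgt a) s' y
  end.

Record polygraph2 : Type := Polygraph2 {
  cell0 : Type;
  cell1 : Type;
  src : cell1 -> cell0;
  tgt : cell1 -> cell0;
  cell2 : Type;
  inputs : cell2 -> seq cell1;
  outputs : cell2 -> seq cell1;
  inputs_neq0 : forall p, inputs p <> [::];
  outputs_neq0 : forall p, outputs p <> [::];
  boundaryP : forall p, exists x y : cell0,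
    is_path src tgt x (inputs p) y /\ is_path src tgt x (outputs p) y
}.

Definition arrow (X : polygraph2) (a : cell1 X) (x y : cell0 X) : Prop :=
  src a = x /\ tgt a = y.

Definition has_boundary (X : polygraph2) (p : cell2 X)
    (Gamma Delta : seq (cell1 X)) : Prop :=
  inputs p = Gamma /\ outputs p = Delta.

(** [Gamma1] and [Gamma2] surround the identified 1-cell among the inputs of the
    second 2-cell, [Delta1] and [Delta2] among the outputs of the first one. *)
Definition planar (C : Type) (Gamma1 Gamma2 Delta1 Delta2 : seq C) : Prop :=
  (Gamma1 = [::] \/ Delta1 = [::]) /\ (Gamma2 = [::] \/ Delta2 = [::]).

(** Positions are counted from 1: [cuttable j i t s] says that the [j]-th output
    of [t] is the [i]-th input of [s] and that cut_{j,i}(t,s) is allowed. *)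
Definition cuttable (X : polygraph2) (j i : nat) (t s : cell2 X) : Prop :=
  exists (Delta1 Delta2 Gamma1 Gamma2 : seq (cell1 X)) (a : cell1 X),
    [/\ outputs t = Delta1 ++ a :: Delta2, j = (size Delta1).+1,
        inputs s = Gamma1 ++ a :: Gamma2, i = (size Gamma1).+1
      & planar Gamma1 Gamma2 Delta1 Delta2].

(** [cut j i t s] is a total function, constrained only when [cuttable j i t s];
    its other values are junk and are never used. *)
Record polybicategory : Type := Polybicategory {
  polygraph_of :> polygraph2;
  cut : nat -> nat -> cell2 polygraph_of -> cell2 polygraph_of ->
        cell2 polygraph_of;
  cut_boundary : forall (t s : cell2 polygraph_of)
      (Gamma Delta1 Delta2 Gamma1 Gamma2 Delta : seq (cell1 polygraph_of))
      (a : cell1 polygraph_of),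
    has_boundary t Gamma (Delta1 ++ a :: Delta2) ->
    has_boundary s (Gamma1 ++ a :: Gamma2) Delta ->
    planar Gamma1 Gamma2 Delta1 Delta2 ->
    has_boundary (cut (size Delta1).+1 (size Gamma1).+1 t s)
      (Gamma1 ++ Gamma ++ Gamma2) (Delta1 ++ Delta ++ Delta2);
  (** Three 2-cells joined along two 1-cells have a middle one, which is joined
      to the others along an input and an output ([cut_assoc]), along two
      outputs ([cut_interchange_out]), or along two inputs
      ([cut_interchange_in]). *)
  cut_assoc : forall (t s r : cell2 polygraph_of) (j i k l : nat),
    cuttable j i t s ->
    cuttable k l s r ->
    cuttable j (l + i).-1 t (cut k l s r) ->
    cuttable (j + k).-1 l (cut j i t s) r ->
    cut j (l + i).-1 t (cut k l s r) = cut (j + k).-1 l (cut j i t s) r;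
  cut_interchange_out : forall (t s r : cell2 polygraph_of) (j i k l : nat),
    j < k ->
    cuttable j i t s ->
    cuttable k l t r ->
    cuttable (k + size (outputs s)).-1 l (cut j i t s) r ->
    cuttable j i (cut k l t r) s ->
    cut (k + size (outputs s)).-1 l (cut j i t s) r = cut j i (cut k l t r) s;
  cut_interchange_in : forall (t s r : cell2 polygraph_of) (j i k l : nat),
    i < l ->
    cuttable j i t r ->
    cuttable k l s r ->
    cuttable k (l + size (inputs t)).-1 s (cut j i t r) ->
    cuttable j i t (cut k l s r) ->
    cut k (l + size (inputs t)).-1 s (cut j i t r) = cut j i t (cut k l s r)
}.

Section Notions.

Variable X : polybicategory.
Implicit Types (t s r : cell2 X) (a b e u v : cell1 X) (x y z : cell0 X).
Implicit Types (Gamma Delta : seq (cell1 X)).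

Definition universal_out (j : nat) t : Prop :=
  exists Delta1 a Delta2,
    [/\ outputs t = Delta1 ++ a :: Delta2, j = (size Delta1).+1
      & forall Gamma1 Gamma2 Delta s,
          Delta <> [::] ->
          planar Gamma1 Gamma2 Delta1 Delta2 ->
          has_boundary s (Gamma1 ++ inputs t ++ Gamma2)
                         (Delta1 ++ Delta ++ Delta2) ->
          exists! r, has_boundary r (Gamma1 ++ a :: Gamma2) Delta /\
                     s = cut j (size Gamma1).+1 t r].

Definition universal_in (i : nat) t : Prop :=
  exists Gamma1 a Gamma2,
    [/\ inputs t = Gamma1 ++ a :: Gamma2, i = (size Gamma1).+1
      & forall Delta1 Delta2 Gamma s,
          Gamma <> [::] ->
          planar Gamma1 Gamma2 Delta1 Delta2 ->
          has_boundary s (Gamma1 ++ Gamma ++ Gamma2)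
                         (Delta1 ++ outputs t ++ Delta2) ->
          exists! r, has_boundary r Gamma (Delta1 ++ a :: Delta2) /\
                     s = cut (size Delta1).+1 i r t].

Definition is_unit a t : Prop :=
  [/\ has_boundary t [:: a] [:: a],
      forall (j : nat) s, cuttable j 1 s t -> cut j 1 s t = s
    & forall (i : nat) s, cuttable 1 i t s -> cut 1 i t s = s].

Definition unital : Prop := forall a, exists t, is_unit a t.

Definition is_tensor_unit x e : Prop :=
  [/\ arrow e x x,
      forall y a, arrow a x y ->
        exists t, [/\ has_boundary t [:: e; a] [:: a],
                      universal_out 1 t & universal_in 2 t]
    & forall z b, arrow b z x ->
        exists t, [/\ has_boundary t [:: b; e] [:: b],
                      universal_out 1 t & universal_in 1 t]].

Definition tensor_left_universal e : Prop :=
  (forall y a, arrow a (src e) y ->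
     exists u t, [/\ arrow u (tgt e) y, has_boundary t [:: e; u] [:: a],
                     universal_out 1 t & universal_in 2 t]) /\
  (forall y a', arrow a' (tgt e) y ->
     exists v t, [/\ arrow v (src e) y, has_boundary t [:: e; a'] [:: v],
                     universal_out 1 t & universal_in 2 t]).

Definition tensor_right_universal e : Prop :=
  (forall z b', arrow b' z (tgt e) ->
     exists u t, [/\ arrow u z (src e), has_boundary t [:: u; e] [:: b'],
                     universal_out 1 t & universal_in 1 t]) /\
  (forall z b, arrow b z (src e) ->
     exists v t, [/\ arrow v z (tgt e), has_boundary t [:: b; e] [:: v],
                     universal_out 1 t & universal_in 1 t]).

Definition tensor_universal e : Prop :=
  tensor_left_universal e /\ tensor_right_universal e.

End Notions.

(* Main.v *)
Require Import Defs.
From mathcomp Require Import all_boot.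
From mathcomp Require Import zify.

(** A tensor unit [u] is itself tensor universal, its unitors being the required
    universal cells, so everything reduces to producing a tensor unit at either
    end of a tensor universal 1-cell [e].

    At the source of [e], right universality of [e] applied to [e] gives a
    universal cell [t : (u, e) -> (e)], which says that [u] acts trivially on
    [e]. Every 1-cell [a] out of the same 0-cell is a tensor product of [e] with
    some [c], by a universal [p : (e, c) -> (a)]; letting [t] act on the factor
    [e] and dividing by [p] gives the left unitor [l : (u, a) -> (a)], the cell
    with cut(t, p) = cut(p, l). Every 1-cell [b] into that 0-cell has a tensor
    product with [e], by a universal [q : (b, e) -> (v)], and dividing
    cut(t, q) by [q] gives the right unitor [r : (b, u) -> (b)].

    Universality of a unitor means that cutting with it is a bijection between
    two sets of 2-cells. This follows from the commuting square
<<
          A  ---- cut with the unitor ----> B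
          |                                 |
       division                          division
          v                                 v
          C  -------- cut with t ---------> D
>>
    whose vertical maps cut with a universal cell that introduces an [e] next to
    the place where [u] is inserted ([bijects_square]). The [e] comes from the
    1-cell that follows this place: as it starts where [e] does, it is [e]
    tensored with something. When no input follows, the [e] is introduced
    instead by tensoring the last output with [e] on the right. The squares
    commute because, next to an [e], cutting with a unitor amounts to cutting
    with [t] ([left_unitor_absorbed], [right_unitor_absorbed]).

    A tensor unit at the target of [e] is obtained by applying this to the
    poly-bicategory with all sequences of 1-cells reversed
    ([rev_polybicategory]). *)

Set Implicit Arguments.
Unset Strict Implicit.
Unset Printing Implicit Defensive.

(** * Cells with a given boundary and bijections between them *)

(** The boundary comes first, so that [hom Gamma Delta] is a set of 2-cells. *)
Definition hom (X : polygraph2) (Gamma Delta : seq (cell1 X)) (p : cell2 X) :=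
  has_boundary p Gamma Delta.

Definition bijects (T : Type) (A B : T -> Prop) (f : T -> T) : Prop :=
  (forall r, A r -> B (f r)) /\
  (forall s, B s -> exists! r, A r /\ s = f r).

Lemma bijects_inj T (A B : T -> Prop) f r r' :
  bijects A B f -> A r -> A r' -> f r = f r' -> r = r'.
Proof.
move=> [fAB bij] Ar Ar' eqf; have [r0 [_ uniq]] := bij _ (fAB _ Ar).
by rewrite -(uniq r) // (uniq r').
Qed.

Lemma bijects_surj T (A B : T -> Prop) f s :
  bijects A B f -> B s -> exists2 r, A r & s = f r.
Proof. by move=> [_ bij] /bij [r [[]]]; exists r. Qed.

(** Three sides of a commuting square being bijective, so is the fourth: this
    is how universality of [t] and of the cells that divide by [e] is passed on
    to the unitors. *)
Lemma bijects_square T (A B C D : T -> Prop) (f g h k : T -> T) :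
  bijects A C h -> bijects C D k -> bijects B D g ->
  (forall r, A r -> B (f r)) ->
  (forall r, A r -> g (f r) = k (h r)) ->
  bijects A B f.
Proof.
move=> bh bk bg fAB comm; split=> // s Bs.
have [y Cy gs] := bijects_surj bk (bg.1 _ Bs).
have [r Ar yE] := bijects_surj bh Cy.
exists r; split=> [|r' [Ar' sE]].
  split=> //; apply: (bijects_inj bg) => //; first exact: fAB.
  by rewrite gs yE comm.
apply: (bijects_inj bh) => //; apply: (bijects_inj bk); try exact: bh.1.
by rewrite -!comm // -sE gs yE -comm.
Qed.

Lemma bijects_ext T (A A' B B' : T -> Prop) f f' :
  (forall r, A r <-> A' r) -> (forall s, B s <-> B' s) ->
  (forall r, A r -> f r = f' r) -> bijects A B f -> bijects A' B' f'.
Proof.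
move=> eA eB ef [fAB bij]; split=> [r /eA Ar | s /eB /bij [r [[Ar sE] uniq]]].
  by rewrite -ef //; apply/eB/fAB.
exists r; split; first by split; [apply/eA | rewrite -ef].
by move=> r' [/eA Ar' sE']; apply: uniq; rewrite ef.
Qed.

(** * Cuts of cells with known boundary *)

Ltac planar_tac := split; solve [by left | by right].

Lemma hom_cut (X : polybicategory) (t s : cell2 X)
    (Gamma Delta1 Delta2 Gamma1 Gamma2 Delta : seq (cell1 X)) (a : cell1 X) :
  hom Gamma (Delta1 ++ a :: Delta2) t -> hom (Gamma1 ++ a :: Gamma2) Delta s ->
  planar Gamma1 Gamma2 Delta1 Delta2 ->
  hom (Gamma1 ++ Gamma ++ Gamma2) (Delta1 ++ Delta ++ Delta2)
      (cut (size Delta1).+1 (size Gamma1).+1 t s).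
Proof. exact: cut_boundary. Qed.

Lemma hom_precut (X : polybicategory) (t s : cell2 X)
    (Gamma Gamma1 Gamma2 Delta : seq (cell1 X)) (a : cell1 X) :
  hom Gamma [:: a] t -> hom (Gamma1 ++ a :: Gamma2) Delta s ->
  hom (Gamma1 ++ Gamma ++ Gamma2) Delta (cut 1 (size Gamma1).+1 t s).
Proof.
move=> ht hs; have := @hom_cut X t s _ [::] [::] _ _ _ _ ht hs.
by rewrite /= cats0; apply; planar_tac.
Qed.

Lemma hom_cuttable (X : polybicategory) (t s : cell2 X) j i
    (Gamma Delta1 Delta2 Gamma1 Gamma2 Delta : seq (cell1 X)) (a : cell1 X) :
  hom Gamma (Delta1 ++ a :: Delta2) t -> hom (Gamma1 ++ a :: Gamma2) Delta s ->
  planar Gamma1 Gamma2 Delta1 Delta2 ->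
  j = (size Delta1).+1 -> i = (size Gamma1).+1 -> cuttable j i t s.
Proof. by move=> [_ outE] [inE _] pl -> ->; exists Delta1, Delta2, Gamma1, Gamma2, a. Qed.

(** Planarity of the two iterated cuts implies that of the two simple ones, but
    not conversely. *)
Lemma cut_assoc_hom (X : polybicategory) (t s r : cell2 X)
    (Gamma Gamma1 Gamma2 Gamma3 Gamma4 Delta1 Delta2 Delta3 Delta4 Delta
      : seq (cell1 X)) (a b : cell1 X) :
  hom Gamma (Delta1 ++ a :: Delta2) t ->
  hom (Gamma1 ++ a :: Gamma2) (Delta3 ++ b :: Delta4) s ->
  hom (Gamma3 ++ b :: Gamma4) Delta r ->
  planar (Gamma3 ++ Gamma1) (Gamma2 ++ Gamma4) Delta1 Delta2 ->
  planar Gamma3 Gamma4 (Delta1 ++ Delta3) (Delta4 ++ Delta2) ->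
  cut (size Delta1).+1 (size (Gamma3 ++ Gamma1)).+1 t
      (cut (size Delta3).+1 (size Gamma3).+1 s r) =
  cut (size (Delta1 ++ Delta3)).+1 (size Gamma3).+1
      (cut (size Delta1).+1 (size Gamma1).+1 t s) r.
Proof.
move=> ht hs hr pt pr.
have pts : planar Gamma1 Gamma2 Delta1 Delta2.
  by move: pt; rewrite /planar; case: (Gamma3); case: (Gamma1); case: (Gamma2) => //=;
     intuition discriminate.
have psr : planar Gamma3 Gamma4 Delta3 Delta4.
  by move: pr; rewrite /planar; case: (Delta1); case: (Delta3); case: (Delta4) => //=;
     intuition discriminate.
have hsr := hom_cut hs hr psr; have hts := hom_cut ht hs pts.
have := @cut_assoc X t s r (size Delta1).+1 (size Gamma1).+1
  (size Delta3).+1 (size Gamma3).+1.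
rewrite !addnS !addSn /= -!size_cat; apply.
- exact: hom_cuttable ht hs pts _ _.
- exact: hom_cuttable hs hr psr _ _.
- apply: hom_cuttable ht _ pt _ _ => //.
  by move: hsr; rewrite -!catA; exact.
- apply: hom_cuttable _ hr pr _ _ => //.
  by move: hts; rewrite -!catA; exact.
Qed.

(** As the outputs of both [t] and [s] are joined to inputs of [r], with [t] on
    the left, planarity leaves no output of [t] on the right of [a] and no
    output of [s] on the left of [b]. *)
Lemma cut_interchange_hom (X : polybicategory) (t s r : cell2 X)
    (Gammat Gammas Gamma1 Gamma2 Gamma3 Deltat Deltas Delta : seq (cell1 X))
    (a b : cell1 X) :
  hom Gammat (Deltat ++ [:: a]) t -> hom Gammas (b :: Deltas) s ->
  hom (Gamma1 ++ a :: Gamma2 ++ b :: Gamma3) Delta r ->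
  Gamma1 = [::] \/ Deltat = [::] -> Gamma3 = [::] \/ Deltas = [::] ->
  cut 1 (size (Gamma1 ++ Gammat ++ Gamma2)).+1 s
      (cut (size Deltat).+1 (size Gamma1).+1 t r) =
  cut (size Deltat).+1 (size Gamma1).+1 t
      (cut 1 (size (Gamma1 ++ a :: Gamma2)).+1 s r).
Proof.
move=> ht hs hr plt pls.
have hr' : hom ((Gamma1 ++ a :: Gamma2) ++ b :: Gamma3) Delta r.
  by rewrite -catA.
have plt' Gamma : planar Gamma1 Gamma Deltat [::] by split; [|right].
have pls' Gamma : planar Gamma Gamma3 [::] Deltas by split; [right|].
have htr := hom_cut ht hr (plt' _).
have hsr := @hom_cut X s r _ [::] Deltas _ _ _ _ hs hr' (pls' _).
have := @cut_interchange_in X t s r (size Deltat).+1 (size Gamma1).+1 1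
  (size (Gamma1 ++ a :: Gamma2)).+1.
have -> : ((size (Gamma1 ++ a :: Gamma2)).+1 + size (inputs t)).-1 =
          (size (Gamma1 ++ Gammat ++ Gamma2)).+1.
  by rewrite ht.1 !size_cat /=; lia.
apply.
- by rewrite size_cat /=; lia.
- exact: hom_cuttable ht hr (plt' _) _ _.
- by apply: (@hom_cuttable X s r _ _ _ [::] _ _ _ _ _ hs hr').
- apply: (@hom_cuttable X s _ _ _ _ [::] _ (Gamma1 ++ Gammat ++ Gamma2)
    Gamma3 (Deltat ++ Delta) b hs) => //.
  by rewrite -!catA; rewrite cats0 in htr.
- apply: (@hom_cuttable X t _ _ _ _ Deltat [::] Gamma1
    (Gamma2 ++ Gammas ++ Gamma3) (Delta ++ Deltas) a ht) => //.
  by rewrite -!catA in hsr.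
Qed.

Lemma precut_precut (X : polybicategory) (t p r : cell2 X) (a b : cell1 X)
    Gamma Gamma1 Gamma2 Gamma3 Gamma4 Delta :
  hom Gamma [:: a] t -> hom (Gamma1 ++ a :: Gamma2) [:: b] p ->
  hom (Gamma3 ++ b :: Gamma4) Delta r ->
  cut 1 (size (Gamma3 ++ Gamma1)).+1 t (cut 1 (size Gamma3).+1 p r) =
  cut 1 (size Gamma3).+1 (cut 1 (size Gamma1).+1 t p) r.
Proof.
move=> ht hp hr.
by apply: (@cut_assoc_hom X t p r Gamma Gamma1 Gamma2 Gamma3 Gamma4 [::] [::]
  [::] [::] Delta a b ht hp hr); planar_tac.
Qed.

Lemma hom_path (X : polygraph2) (p : cell2 X) Gamma Delta :
  hom Gamma Delta p -> exists x y : cell0 X,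
    is_path (@src X) (@tgt X) x Gamma y /\ is_path (@src X) (@tgt X) x Delta y.
Proof. by move=> [<- <-]; exact: boundaryP. Qed.

Lemma is_path_cat C0 C1 (src tgt : C1 -> C0) x y (s1 s2 : seq C1) :
  is_path src tgt x (s1 ++ s2) y ->
  exists2 z, is_path src tgt x s1 z & is_path src tgt z s2 y.
Proof.
elim: s1 x => [|a s1 IH] x /=; first by exists x.
by move=> [<- /IH [z p1 p2]]; exists z.
Qed.

Lemma src_next_input (X : polygraph2) s (u g : cell1 X) G1 G2 D :
  hom (G1 ++ u :: g :: G2) D s -> src g = tgt u.
Proof.
by move=> /hom_path [x0 [y0 [pG _]]]; have [z _ /= [_ []]] := is_path_cat pG.
Qed.

(** * Universality as bijectivity of cutting *)

Definition left_universal_cell (X : polybicategory) (e c a : cell1 X) t : Prop :=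
  [/\ has_boundary t [:: e; c] [:: a], universal_out 1 t & universal_in 2 t].

Definition right_universal_cell (X : polybicategory) (c e a : cell1 X) t : Prop :=
  [/\ has_boundary t [:: c; e] [:: a], universal_out 1 t & universal_in 1 t].

(** With a single output, planarity holds in every context, and outputs of
    2-cells are never empty, so that [Gamma1], [Gamma2] and [Delta] range
    freely. *)
Lemma universal_outP (X : polybicategory) (t : cell2 X) Theta (a : cell1 X) :
  hom Theta [:: a] t ->
  universal_out 1 t <->
  (forall Gamma1 Gamma2 Delta,
     bijects (hom (Gamma1 ++ a :: Gamma2) Delta)
             (hom (Gamma1 ++ Theta ++ Gamma2) Delta)
             (cut 1 (size Gamma1).+1 t)).
Proof.
move=> ht; split.
  move=> [D1 [a' [D2 [oE]]]]; case: D1 oE => [|? ?] //; rewrite ht.2 /=.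
  case=> <- <- _ univ Gamma1 Gamma2 Delta; split=> [r hr | s hs].
    exact: hom_precut ht hr.
  have [] // := univ Gamma1 Gamma2 Delta s.
  - by rewrite -hs.2; exact: outputs_neq0.
  - by planar_tac.
  - by rewrite /= cats0 ht.1.
  by move=> r hr; exists r.
move=> bij; exists [::], a, [::]; split=> //; first exact: ht.2.
move=> Gamma1 Gamma2 Delta s _ _; rewrite /= cats0 ht.1.
by apply: (bij _ _ _).2.
Qed.

(** The input [e] on the left forbids further outputs on the left, so that the
    context consists of outputs on the right only. *)
Lemma universal_in2P (X : polybicategory) (t : cell2 X) (e c a : cell1 X) :
  hom [:: e; c] [:: a] t ->
  universal_in 2 t <->
  (forall Gamma Delta, Gamma <> [::] ->
     bijects (hom Gamma (c :: Delta)) (hom (e :: Gamma) (a :: Delta))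
             (fun r => cut 1 2 r t)).
Proof.
move=> ht; split.
  move=> [G1 [c' [G2 [iE]]]]; case: G1 iE => [|e' [|? ?]] //; rewrite ht.1 /=.
  case=> <- <- <- _ univ Gamma Delta nz; split=> [r hr | s hs].
    have := @hom_cut X r t _ [::] _ [:: e] [::] _ _ hr ht (ltac:(planar_tac)).
    by rewrite /= cats0.
  by apply: (univ [::] Delta) => //; [planar_tac | rewrite /= cats0 ht.2].
move=> bij; exists [:: e], c, [::]; split=> //; first exact: ht.1.
move=> Delta1 Delta2 Gamma s nz [[//|->] _].
by rewrite /= cats0 ht.2; apply: (bij _ _ _).2.
Qed.

Lemma universal_in1P (X : polybicategory) (t : cell2 X) (e c a : cell1 X) :
  hom [:: c; e] [:: a] t ->
  universal_in 1 t <->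
  (forall Gamma Delta, Gamma <> [::] ->
     bijects (hom Gamma (Delta ++ [:: c])) (hom (Gamma ++ [:: e]) (Delta ++ [:: a]))
             (fun r => cut (size Delta).+1 1 r t)).
Proof.
move=> ht; split.
  move=> [G1 [c' [G2 [iE]]]]; case: G1 iE => [|? ?] //; rewrite ht.1 /=.
  case=> <- <- _ univ Gamma Delta nz; split=> [r hr | s hs].
    exact: (@hom_cut X r t _ Delta _ [::] [:: e] _ _ hr ht (ltac:(planar_tac))).
  by apply: (univ Delta [::]) => //; [planar_tac | rewrite ht.2].
move=> bij; exists [::], c, [:: e]; split=> //; first exact: ht.1.
move=> Delta1 Delta2 Gamma s nz [_ [//|->]].
by rewrite /= cats0 ht.2; apply: (bij _ _ _).2.
Qed.

(** * The tensor unit at the source of a tensor universal 1-cell *)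

(** Dividing by [p], a cell with input [e] and output [a] is cut(w, p) for some
    [w], and cutting [p] with [l] is by choice of [l] the same as letting [t]
    act on its input [e]. *)
Lemma left_unitor_absorbed (X : polybicategory) (t p l : cell2 X)
    (e u c a : cell1 X) :
  hom [:: u; e] [:: e] t -> left_universal_cell e c a p ->
  hom [:: u; a] [:: a] l -> cut 1 1 t p = cut 1 2 p l ->
  forall Gamma Delta x, Gamma <> [::] -> hom (e :: Gamma) (a :: Delta) x ->
  cut 1 2 x l = cut 1 1 t x.
Proof.
move=> ht [hp _ univ] hl tp_pl Gamma Delta x nz hx.
have [w hw ->] := bijects_surj ((universal_in2P hp).1 univ Gamma Delta nz) hx.
have := @cut_assoc_hom X w p l Gamma [:: e] [::] [:: u] [::] [::] Delta
  [::] [::] [:: a] c a hw hp hl.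
move=> /= <-; try planar_tac.
rewrite -tp_pl.
by apply: (@cut_interchange_hom X t w p _ _ [::] [::] [::] [::] _ _ _ _ ht hw hp); left.
Qed.

(** The inputs [b] and [e] can be merged by [q], and cutting [r] into the first
    input of [q] is by choice of [r] the same as cutting [t] into the second. *)
Lemma right_unitor_absorbed (X : polybicategory) (t q r : cell2 X)
    (e u b v : cell1 X) :
  hom [:: u; e] [:: e] t -> right_universal_cell b e v q ->
  hom [:: b; u] [:: b] r -> cut 1 2 t q = cut 1 1 r q ->
  forall Gamma1 Gamma2 Delta y, hom (Gamma1 ++ b :: e :: Gamma2) Delta y ->
  cut 1 (size Gamma1).+1 r y = cut 1 (size (Gamma1 ++ [:: b])).+1 t y.
Proof.
move=> ht [hq univ _] hr tq_rq Gamma1 Gamma2 Delta y hy.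
have [w hw ->] := bijects_surj ((universal_outP hq).1 univ Gamma1 Gamma2 Delta) hy.
have := @cut_assoc_hom X r q w _ [::] [:: e] Gamma1 Gamma2 [::] [::]
  [::] [::] _ b v hr hq hw.
rewrite /= cats0 => ->; try planar_tac.
have := @cut_assoc_hom X t q w _ [:: b] [::] Gamma1 Gamma2 [::] [::]
  [::] [::] _ e v ht hq hw.
by move=> /= ->; rewrite ?tq_rq //; planar_tac.
Qed.

(** The vertical maps of the square are cuts with [p], which replaces [a] by
    [e, c]; it commutes by the equation that defines [l]. *)
Lemma left_unitor_universal_out (X : polybicategory) (t p l : cell2 X)
    (e u c a : cell1 X) :
  hom [:: u; e] [:: e] t -> universal_out 1 t -> left_universal_cell e c a p ->
  hom [:: u; a] [:: a] l -> cut 1 1 t p = cut 1 2 p l -> universal_out 1 l.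
Proof.
move=> ht ut [hp up _] hl tp_pl; apply/(universal_outP hl) => G1 G2 D.
have ht' := (universal_outP ht).1 ut; have hp' := (universal_outP hp).1 up.
have hg := hp' (G1 ++ [:: u]) G2 D; rewrite -!catA in hg.
apply: (bijects_square (hp' G1 G2 D) (ht' G1 (c :: G2) D) hg) => r hr.
  exact: hom_precut hl hr.
rewrite (precut_precut (Gamma1 := [:: u]) (Gamma2 := [::]) hp hl hr) -tp_pl.
by rewrite -(precut_precut (Gamma1 := [::]) (Gamma2 := [:: c]) ht hp hr) cats0.
Qed.

(** The 1-cell [g] that follows [u] among the inputs of the cell to be divided
    need not be related to [a]: the vertical maps of the square are cuts with
    another cell [p' : (e, c') -> (g)], and it commutes by
    [left_unitor_absorbed]. *)
Lemma left_unitor_universal_in (X : polybicategory) (t p l : cell2 X)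
    (e u c a : cell1 X) x :
  arrow u x x -> src e = x -> tensor_left_universal e ->
  hom [:: u; e] [:: e] t -> universal_out 1 t -> left_universal_cell e c a p ->
  hom [:: u; a] [:: a] l -> cut 1 1 t p = cut 1 2 p l -> universal_in 2 l.
Proof.
move=> au se [lu _] ht ut hp hl tp_pl; apply/(universal_in2P hl) => G D nz.
have fAB r : hom G (a :: D) r -> hom (u :: G) (a :: D) (cut 1 2 r l).
  move=> hr.
  have := @hom_cut X r l _ [::] _ [:: u] [::] _ _ hr hl (ltac:(planar_tac)).
  by rewrite /= cats0.
(* The boundary of [s] makes [g] start at [x], which is needed to divide it. *)
split=> // s hs; case: G nz fAB hs => // g G' _ fAB hs.
have sg : src g = x by rewrite (src_next_input (G1 := [::]) hs) au.2.
have [//|c' [p' [_ hp' up' _]]] := lu (tgt g) g; first by rewrite /arrow se.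
have ht' := (universal_outP ht).1 ut; have bp' := (universal_outP hp').1 up'.
apply: (bijects_square (bp' [::] G' (a :: D)) (ht' [::] (c' :: G') (a :: D))
  (bp' [:: u] G' (a :: D)) fAB _).2 hs => r hr.
have hpr := hom_precut (Gamma1 := [::]) hp' hr.
have <- := left_unitor_absorbed ht hp hl tp_pl _ hpr => //.
apply: (@cut_assoc_hom X p' r l _ [::] G' [:: u] [::] [::] [::]
  [::] D _ g a hp' hr hl); planar_tac.
Qed.

(** Here nothing follows [u], but the output [b] can be tensored with [e]: the
    vertical maps of the square are cuts into [q], and it commutes by the
    equation that defines [r]. *)
Lemma right_unitor_universal_in (X : polybicategory) (t q r : cell2 X)
    (e u b v : cell1 X) :
  hom [:: u; e] [:: e] t -> universal_out 1 t -> right_universal_cell b e v q ->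
  hom [:: b; u] [:: b] r -> cut 1 2 t q = cut 1 1 r q -> universal_in 1 r.
Proof.
move=> ht ut [hq _ uq] hr tq_rq; apply/(universal_in1P hr) => G D nz.
have bt := (universal_outP ht).1 ut; have bq := (universal_in1P hq).1 uq.
have h2 := bq (G ++ [:: u]) D; rewrite -catA in h2.
have h3 := bt G [::] (D ++ [:: v]).
apply: (bijects_square (bq G D nz) h3 (h2 _)).
- by case: (G).
- move=> w hw.
  have := @hom_cut X w r _ D _ [::] [:: u] _ _ hw hr (ltac:(planar_tac)).
  by rewrite /= ?cats0.
move=> w hw.
have := @cut_assoc_hom X w r q G [::] [:: u] [::] [:: e] D [::] [::] [::] _
  b b hw hr hq.
rewrite /= !cats0 => <-; try planar_tac.
rewrite -tq_rq.
symmetry; have := @cut_interchange_hom X w t q _ _ [::] [::] [::] _ [::] _ _ _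
  hw ht hq.
by rewrite cats0; apply; left.
Qed.

(** An [e] is created after [u] from the next input [g], by
    [p : (e, c) -> (g)], or, when [u] is the last input, from the last output
    [d], which then ends at [x], by [q' : (d, e) -> (v')]. Both squares commute
    by [right_unitor_absorbed]. *)
Lemma right_unitor_universal_out (X : polybicategory) (t q r : cell2 X)
    (e u b v : cell1 X) x :
  arrow u x x -> src e = x -> tensor_universal e ->
  hom [:: u; e] [:: e] t -> universal_out 1 t -> right_universal_cell b e v q ->
  hom [:: b; u] [:: b] r -> cut 1 2 t q = cut 1 1 r q -> universal_out 1 r.
Proof.
move=> au se [[lu _] [_ ru]] ht ut hq hr tq_rq.
have bt := (universal_outP ht).1 ut.
apply/(universal_outP hr) => G1 G2 D; split=> [w hw | s hs].
  exact: hom_precut hr hw.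
case: G2 hs => [|g G2] hs.
  have [z0 [y0 [pG pD]]] := hom_path hs.
  have [? _ /= [_ [_ eu]]] := is_path_cat pG.
  rewrite au.2 in eu; rewrite -{}eu in pD.
  case/lastP: D pD hs => [pD hs | D d pD hs].
    by case: (@outputs_neq0 X s); rewrite hs.2.
  have td : tgt d = x.
    by rewrite -cats1 in pD; have [? _ /= []] := is_path_cat pD.
  have [//|v' [q' [_ hq' _ uq']]] := ru (src d) d; first by rewrite /arrow se.
  have bq' := (universal_in1P hq').1 uq'.
  rewrite -cats1 in hs *.
  have h1 : bijects (hom (G1 ++ [:: b]) (D ++ [:: d]))
     (hom (G1 ++ [:: b; e]) (D ++ [:: v'])) (fun r => cut (size D).+1 1 r q').
    by have := bq' (G1 ++ [:: b]) D; rewrite -catA; apply; case: (G1).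
  have h2 := bt (G1 ++ [:: b]) [::] (D ++ [:: v']); rewrite -!catA /= in h2.
  have h3 : bijects (hom (G1 ++ [:: b; u]) (D ++ [:: d]))
     (hom (G1 ++ [:: b; u; e]) (D ++ [:: v'])) (fun r => cut (size D).+1 1 r q').
    by have := bq' (G1 ++ [:: b; u]) D; rewrite -catA; apply; case: (G1).
  apply: (bijects_square h1 h2 h3 _ _).2 => // w hw.
    exact: hom_precut hr hw.
  rewrite -(right_unitor_absorbed ht hq hr tq_rq (h1.1 _ hw)).
  symmetry; apply: (@cut_assoc_hom X r w q' _ G1 [::] [::] [:: e] [::] [::]
    D [::] _ b d hr hw hq'); planar_tac.
have sg : src g = x.
  by rewrite (@src_next_input X s u g (G1 ++ [:: b]) G2 D) ?au.2 // -catA.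
have [//|c [p [_ hp up _]]] := lu (tgt g) g; first by rewrite /arrow se.
have bp := (universal_outP hp).1 up.
have h1 := bp (G1 ++ [:: b]) G2 D; rewrite -!catA /= in h1.
have h2 := bt (G1 ++ [:: b]) (c :: G2) D; rewrite -!catA /= in h2.
have h3 := bp (G1 ++ [:: b; u]) G2 D; rewrite -!catA /= in h3.
apply: (bijects_square h1 h2 h3 _ _).2 => // w hw.
  exact: hom_precut hr hw.
rewrite -(right_unitor_absorbed ht hq hr tq_rq (h1.1 _ hw)).
by have := @cut_interchange_hom X r p w _ _ G1 [::] G2 [::] [::] _ _ _ hr hp hw;
  apply; right.
Qed.

Lemma tensor_unit_at_src (X : polybicategory) (e : cell1 X) :
  tensor_universal e -> exists u, is_tensor_unit (src e) u.
Proof.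
move=> ue; have [lu [ru1 ru2]] := ue.
have [//|u [t [au ht ut _]]] := ru1 (src e) e.
exists u; split=> // [y a aa | z b ab].
  have [c [p [_ hp up ip]]] := lu.1 y a aa.
  have htp := hom_precut (Gamma1 := [::]) ht hp.
  have [l hl tp_pl] := bijects_surj ((universal_outP hp).1 up [:: u] [::] [:: a]) htp.
  have pP : left_universal_cell e c a p by [].
  exists l; split=> //.
    exact: left_unitor_universal_out ht ut pP hl tp_pl.
  exact: left_unitor_universal_in au erefl lu ht ut pP hl tp_pl.
have [v [q [_ hq uq iq]]] := ru2 z b ab.
have htq := hom_precut (Gamma1 := [:: b]) ht hq.
have qP : right_universal_cell b e v q by [].
have nz : [:: b; u] <> [::] by [].
have [r hr tq_rq] := bijects_surj ((universal_in1P hq).1 iq [:: b; u] [::] nz) htq.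
exists r; split=> //.
  exact: right_unitor_universal_out au erefl ue ht ut qP hr tq_rq.
exact: right_unitor_universal_in ht ut qP hr tq_rq.
Qed.

(** * Left-right reversal *)

Lemma is_path_rev C0 C1 (src tgt : C1 -> C0) x y (s : seq C1) :
  is_path src tgt x s y -> is_path tgt src y (rev s) x.
Proof.
have rcons_path z a s' w : is_path tgt src z s' w -> tgt a = w ->
    is_path tgt src z (rcons s' a) (src a).
  by elim: s' z => [|b s' IH] z /= => [-> -> | [-> /IH p] /p].
elim: s x => [|a s IH] x /=; first by move->.
by move=> [<- /IH p]; rewrite rev_cons; exact: rcons_path p _.
Qed.

Definition rev_polygraph (X : polygraph2) : polygraph2.
Proof.
refine (@Polygraph2 (cell0 X) (cell1 X) (@tgt X) (@src X) (cell2 X)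
  (fun p => rev (inputs p)) (fun p => rev (outputs p)) _ _ _).
- by move=> p /(congr1 rev); rewrite revK; exact: inputs_neq0.
- by move=> p /(congr1 rev); rewrite revK; exact: outputs_neq0.
- move=> p; have [x [y [pi po]]] := boundaryP p.
  by exists y, x; split; exact: is_path_rev.
Defined.

(** Position of the [k]-th entry of [s], counted from 1, when read from the
    right. *)
Definition mirror (C : Type) (s : seq C) (k : nat) := (size s - k).+1.

Lemma hom_rev (X : polygraph2) (p : cell2 X) Gamma Delta :
  @hom (rev_polygraph X) Gamma Delta p <-> @hom X (rev Gamma) (rev Delta) p.
Proof.
by split=> -[/= iE oE]; split; rewrite /= -?iE -?oE ?revK // ?iE ?oE revK.
Qed.

Lemma planar_rev C (Gamma1 Gamma2 Delta1 Delta2 : seq C) :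
  planar Gamma1 Gamma2 Delta1 Delta2 ->
  planar (rev Gamma2) (rev Gamma1) (rev Delta2) (rev Delta1).
Proof. by move=> [[]-> []->]; split; by [left | right]. Qed.

Lemma cuttable_rev (X : polygraph2) j i (t s : cell2 X) :
  @cuttable (rev_polygraph X) j i t s ->
  @cuttable X (mirror (outputs t) j) (mirror (inputs s) i) t s.
Proof.
move=> [D1 [D2 [G1 [G2 [a [/= oE -> iE -> pl]]]]]].
exists (rev D2), (rev D1), (rev G2), (rev G1), a.
split; last exact: planar_rev.
- by rewrite -[LHS]revK oE rev_cat rev_cons cat_rcons.
- by rewrite /mirror -(size_rev (outputs t)) oE size_cat size_rev /=; lia.
- by rewrite -[LHS]revK iE rev_cat rev_cons cat_rcons.
- by rewrite /mirror -(size_rev (inputs s)) iE size_cat size_rev /=; lia.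
Qed.

Lemma cuttable_bounds (X : polygraph2) j i (t s : cell2 X) :
  cuttable j i t s -> 0 < j <= size (outputs t) /\ 0 < i <= size (inputs s).
Proof.
move=> [D1 [D2 [G1 [G2 [a [-> -> -> -> _]]]]]].
by rewrite !size_cat /= !addnS !ltnS !leq_addr.
Qed.

Lemma size_cut (X : polybicategory) j i (t s : cell2 X) :
  cuttable j i t s ->
  size (inputs (cut j i t s)) = (size (inputs t) + size (inputs s)).-1 /\
  size (outputs (cut j i t s)) = (size (outputs t) + size (outputs s)).-1.
Proof.
move=> [D1 [D2 [G1 [G2 [a [oE -> iE -> pl]]]]]].
have [-> ->] := @cut_boundary X t s _ _ _ _ _ _ a (conj erefl oE) (conj iE erefl) pl.
by rewrite iE oE !size_cat /=; lia.
Qed.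

Definition rev_cut (X : polybicategory) j i (t s : cell2 X) : cell2 X :=
  cut (mirror (outputs t) j) (mirror (inputs s) i) t s.

(** Mirroring turns the positions of an associativity equation into those of
    another one, and exchanges the two sides of the interchange equations, as
    the left and right of the two cells joined to the middle one are
    swapped. *)
Definition rev_polybicategory (X : polybicategory) : polybicategory.
Proof.
refine (@Polybicategory (rev_polygraph X) (@rev_cut X) _ _ _ _).
- move=> t s Gamma D1 D2 G1 G2 Delta a ht hs pl.
  move/hom_rev: (ht); move/hom_rev: (hs).
  rewrite !rev_cat !rev_cons !cat_rcons => hs' ht'.
  have -> : rev_cut (size D1).+1 (size G1).+1 t s =
      cut (size (rev D2)).+1 (size (rev G2)).+1 t s.
    by rewrite /rev_cut /mirror ht'.2 hs'.1 !size_cat /= !size_rev;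
       congr cut; lia.
  apply/hom_rev; rewrite !rev_cat -!catA.
  exact: hom_cut ht' hs' (planar_rev pl).
- move=> /= t s r j i k l /[dup] /cuttable_rev c1 /cuttable_bounds /= b1.
  move=> /[dup] /cuttable_rev c2 /cuttable_bounds /= b2.
  move=> /cuttable_rev c3 /cuttable_rev c4.
  rewrite !size_rev in b1 b2.
  rewrite /rev_cut in c3 c4 *.
  have e3 : mirror (inputs (cut (mirror (outputs s) k) (mirror (inputs r) l) s r))
      (l + i).-1 = (mirror (inputs r) l + mirror (inputs s) i).-1.
    by rewrite /mirror (size_cut c2).1; lia.
  have e4 : mirror (outputs (cut (mirror (outputs t) j) (mirror (inputs s) i) t s))
      (j + k).-1 = (mirror (outputs t) j + mirror (outputs s) k).-1.
    by rewrite /mirror (size_cut c1).2; lia.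
  rewrite e3 in c3 *; rewrite e4 in c4 *; exact: cut_assoc.
- move=> /= t s r j i k l jk /[dup] /cuttable_rev c1 /cuttable_bounds /= b1.
  move=> /[dup] /cuttable_rev c2 /cuttable_bounds /= b2.
  move=> /cuttable_rev c3 /cuttable_rev c4.
  rewrite /= !size_rev in b1 b2 c3 *.
  rewrite /rev_cut in c3 c4 *.
  have e3 : mirror (outputs (cut (mirror (outputs t) j) (mirror (inputs s) i) t s))
      (k + size (outputs s)).-1 = mirror (outputs t) k.
    by rewrite /mirror (size_cut c1).2; lia.
  have e4 : mirror (outputs (cut (mirror (outputs t) k) (mirror (inputs r) l) t r)) j
      = (mirror (outputs t) j + size (outputs r)).-1.
    by rewrite /mirror (size_cut c2).2; lia.
  rewrite e3 in c3 *; rewrite e4 in c4 *; symmetry.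
  by apply: cut_interchange_out => //; rewrite /mirror; lia.
- move=> /= t s r j i k l il /[dup] /cuttable_rev c1 /cuttable_bounds /= b1.
  move=> /[dup] /cuttable_rev c2 /cuttable_bounds /= b2.
  move=> /cuttable_rev c3 /cuttable_rev c4.
  rewrite /= !size_rev in b1 b2 c3 *.
  rewrite /rev_cut in c3 c4 *.
  have e3 : mirror (inputs (cut (mirror (outputs t) j) (mirror (inputs r) i) t r))
      (l + size (inputs t)).-1 = mirror (inputs r) l.
    by rewrite /mirror (size_cut c1).1; lia.
  have e4 : mirror (inputs (cut (mirror (outputs s) k) (mirror (inputs r) l) s r)) i
      = (mirror (inputs r) i + size (inputs s)).-1.
    by rewrite /mirror (size_cut c2).1; lia.
  rewrite e3 in c3 *; rewrite e4 in c4 *; symmetry.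
  by apply: cut_interchange_in => //; rewrite /mirror; lia.
Defined.

Lemma universal_out_rev (X : polybicategory) (t : cell2 X) Theta (a : cell1 X) :
  @hom X Theta [:: a] t ->
  universal_out (X := rev_polybicategory X) 1 t <-> universal_out (X := X) 1 t.
Proof.
move=> ht.
have ht' : @hom (rev_polybicategory X) (rev Theta) [:: a] t.
  by apply/hom_rev; rewrite revK.
have homE p G D : @hom (rev_polybicategory X) G D p <-> @hom X (rev G) (rev D) p.
  exact: hom_rev.
have eqf G1 G2 D r : @hom X (rev G2 ++ a :: rev G1) D r ->
    @cut (rev_polybicategory X) 1 (size G1).+1 t r = cut 1 (size (rev G2)).+1 t r.
  move=> hr; rewrite /cut /= /rev_cut /mirror ht.2 hr.1 size_cat /= !size_rev.
  by congr Defs.cut; lia.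
split=> [/(universal_outP ht') U | /(universal_outP ht) U].
  apply/(universal_outP ht) => G1 G2 D.
  apply: bijects_ext (U (rev G2) (rev G1) (rev D)) => r.
  - by rewrite homE rev_cat rev_cons cat_rcons !revK.
  - by rewrite homE !rev_cat -catA !revK.
  - rewrite homE rev_cat rev_cons cat_rcons => hr.
    by rewrite (eqf _ _ _ _ hr) revK.
apply/(universal_outP ht') => G1 G2 D.
apply: bijects_ext (U (rev G2) (rev G1) (rev D)) => r.
- by rewrite homE rev_cat rev_cons cat_rcons.
- by rewrite homE !rev_cat -catA !revK.
- by move=> hr; rewrite (eqf _ _ _ _ hr).
Qed.

Lemma rev_neq_nil (T : Type) (s : seq T) : s <> [::] -> rev s <> [::].
Proof. by move=> nz /(congr1 rev); rewrite revK. Qed.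

Lemma universal_in2_rev (X : polybicategory) (t : cell2 X) (e c a : cell1 X) :
  @hom X [:: c; e] [:: a] t ->
  universal_in (X := rev_polybicategory X) 2 t <-> universal_in (X := X) 1 t.
Proof.
move=> ht.
have ht' : @hom (rev_polybicategory X) [:: e; c] [:: a] t by apply/hom_rev.
have homE p G D : @hom (rev_polybicategory X) G D p <-> @hom X (rev G) (rev D) p.
  exact: hom_rev.
have eqf G D r : @hom X G (D ++ [:: c]) r ->
    @cut (rev_polybicategory X) 1 2 r t = cut (size D).+1 1 r t.
  move=> hr; rewrite /cut /= /rev_cut /mirror ht.1 hr.2 size_cat /=.
  by congr Defs.cut; lia.
split=> [/(universal_in2P ht') U | /(universal_in1P ht) U].
  apply/(universal_in1P ht) => G D nz.
  apply: bijects_ext (U (rev G) (rev D) (rev_neq_nil nz)) => r.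
  - by rewrite homE rev_cons !revK cats1.
  - by rewrite homE !rev_cons !revK !cats1.
  - by rewrite homE rev_cons !revK -cats1; exact: eqf.
apply/(universal_in2P ht') => G D nz.
apply: bijects_ext (U (rev G) (rev D) (rev_neq_nil nz)) => r.
- by rewrite homE rev_cons cats1.
- by rewrite homE !rev_cons !cats1.
- by move=> hr; rewrite (eqf _ _ _ hr).
Qed.

Lemma universal_in1_rev (X : polybicategory) (t : cell2 X) (e c a : cell1 X) :
  @hom X [:: e; c] [:: a] t ->
  universal_in (X := rev_polybicategory X) 1 t <-> universal_in (X := X) 2 t.
Proof.
move=> ht.
have ht' : @hom (rev_polybicategory X) [:: c; e] [:: a] t by apply/hom_rev.
have homE p G D : @hom (rev_polybicategory X) G D p <-> @hom X (rev G) (rev D) p.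
  exact: hom_rev.
have eqf G D r : @hom X G (c :: rev D) r ->
    @cut (rev_polybicategory X) (size D).+1 1 r t = cut 1 2 r t.
  move=> hr; rewrite /cut /= /rev_cut /mirror ht.1 hr.2 /= size_rev.
  by congr Defs.cut; lia.
split=> [/(universal_in1P ht') U | /(universal_in2P ht) U].
  apply/(universal_in2P ht) => G D nz.
  apply: bijects_ext (U (rev G) (rev D) (rev_neq_nil nz)) => r.
  - by rewrite homE rev_cat !revK.
  - by rewrite homE !rev_cat !revK.
  - by rewrite homE rev_cat => hr; rewrite (eqf _ _ _ hr).
apply/(universal_in1P ht') => G D nz.
apply: bijects_ext (U (rev G) (rev D) (rev_neq_nil nz)) => r.
- by rewrite homE rev_cat.
- by rewrite homE !rev_cat.
- by move=> hr; rewrite (eqf _ _ _ hr).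
Qed.

Lemma left_universal_cell_rev (X : polybicategory) (t : cell2 X) (e c a : cell1 X) :
  left_universal_cell (X := rev_polybicategory X) e c a t <->
  right_universal_cell (X := X) c e a t.
Proof.
split=> [[/hom_rev ht uo ui] | [ht uo ui]]; split.
- exact: ht.
- exact/(universal_out_rev ht).
- exact/(universal_in2_rev ht).
- exact/hom_rev.
- exact/(universal_out_rev ht).
- exact/(universal_in2_rev ht).
Qed.

Lemma right_universal_cell_rev (X : polybicategory) (t : cell2 X) (e c a : cell1 X) :
  right_universal_cell (X := rev_polybicategory X) c e a t <->
  left_universal_cell (X := X) e c a t.
Proof.
split=> [[/hom_rev ht uo ui] | [ht uo ui]]; split.
- exact: ht.
- exact/(universal_out_rev ht).
- exact/(universal_in1_rev ht).
- exact/hom_rev.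
- exact/(universal_out_rev ht).
- exact/(universal_in1_rev ht).
Qed.

Lemma arrow_rev (X : polygraph2) (a : cell1 X) x y :
  @arrow (rev_polygraph X) a x y <-> arrow a y x.
Proof. by split=> -[]. Qed.

Lemma tensor_universal_rev (X : polybicategory) (e : cell1 X) :
  tensor_universal e -> tensor_universal (X := rev_polybicategory X) e.
Proof.
move=> [[l1 l2] [r1 r2]]; split; split=> y a /arrow_rev aa.
- have [u [t [au ht uo ui]]] := r1 y a aa.
  have [] := (left_universal_cell_rev t e u a).2 (And3 ht uo ui).
  by exists u, t; split=> //; apply/arrow_rev.
- have [v [t [av ht uo ui]]] := r2 y a aa.
  have [] := (left_universal_cell_rev t e a v).2 (And3 ht uo ui).
  by exists v, t; split=> //; apply/arrow_rev.
- have [u [t [au ht uo ui]]] := l1 y a aa.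
  have [] := (right_universal_cell_rev t e u a).2 (And3 ht uo ui).
  by exists u, t; split=> //; apply/arrow_rev.
- have [v [t [av ht uo ui]]] := l2 y a aa.
  have [] := (right_universal_cell_rev t e a v).2 (And3 ht uo ui).
  by exists v, t; split=> //; apply/arrow_rev.
Qed.

Lemma is_tensor_unit_rev (X : polybicategory) x (u : cell1 X) :
  is_tensor_unit (X := rev_polybicategory X) x u -> is_tensor_unit (X := X) x u.
Proof.
move=> [/arrow_rev au lu ru]; split=> // y a aa.
- have [t [ht uo ui]] := ru y a ((arrow_rev _ _ _).2 aa).
  have [] := (@right_universal_cell_rev X t u a a).1 (And3 ht uo ui).
  by exists t.
- have [t [ht uo ui]] := lu y a ((arrow_rev _ _ _).2 aa).
  have [] := (@left_universal_cell_rev X t u a a).1 (And3 ht uo ui).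
  by exists t.
Qed.

Lemma tensor_unit_at_tgt (X : polybicategory) (e : cell1 X) :
  tensor_universal e -> exists u, is_tensor_unit (tgt e) u.
Proof.
by move=> /tensor_universal_rev /tensor_unit_at_src [u /is_tensor_unit_rev]; exists u.
Qed.

(** * Equivalence of the three conditions *)

Lemma tensor_unit_universal (X : polybicategory) x (u : cell1 X) :
  is_tensor_unit x u -> tensor_universal u.
Proof.
move=> [[su tu] lu ru].
split; split=> y a; rewrite ?su ?tu => aa.
- by have [t [ht uo ui]] := lu y a aa; exists a, t.
- by have [t [ht uo ui]] := lu y a aa; exists a, t.
- by have [t [ht uo ui]] := ru y a aa; exists a, t.
- by have [t [ht uo ui]] := ru y a aa; exists a, t.
Qed.

Theorem theorem3p10 (X : polybicategory) (hX : unital X) :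
  ((forall x : cell0 X, exists (xbar : cell0 X) (e : cell1 X),
      arrow e x xbar /\ tensor_universal e)
   <->
   (forall x : cell0 X, exists (xbar : cell0 X) (e' : cell1 X),
      arrow e' xbar x /\ tensor_universal e'))
  /\
  ((forall x : cell0 X, exists (xbar : cell0 X) (e' : cell1 X),
      arrow e' xbar x /\ tensor_universal e')
   <->
   (forall x : cell0 X, exists e : cell1 X, is_tensor_unit x e)).
Proof.
split; split=> H x; have := H x.
- move=> [? [e [[<- _] /tensor_unit_at_src [u uu]]]].
  by exists (src e), u; split; [case: uu | exact: tensor_unit_universal uu].
- move=> [? [e [[_ <-] /tensor_unit_at_tgt [u uu]]]].
  by exists (tgt e), u; split; [case: uu | exact: tensor_unit_universal uu].
- by move=> [? [e [[_ <-] /tensor_unit_at_tgt]]].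
- by move=> [u uu]; exists x, u; split; [case: uu | exact: tensor_unit_universal uu].
Qed.
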